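(* Let $G$ be a nilpotent $p$-group of class $k$, with $k\geq 1$ and $p$ a prime. Furthermore, let $\{x_1,\ldots,x_r\}$ be a generating set for $G$ with $x_i$ of order $p^{\alpha_i}$, where $\alpha_1\leq\alpha_2\leq\cdots\leq\alpha_r$. If $G$ is capable, then $r>1$ and \[\alpha_{r}\leq\alpha_{r-1}+\left\lfloor\frac{k-1}{p-1}\right\rfloor.\]
   Context: A group $G$ is capable if and only if there exists a group $H$ such that $G\cong H/Z(H)$, where $Z(H)$ denotes the center of $H$. The lower central series of $G$ is defined by $G_1=G$, $G_{n+1}=[G_n,G]$, where $[G_n,G]$ is the subgroup generated by all commutators $[a,b]=a^{-1}b^{-1}ab$ with $a\in G_n$, $b\in G$. A group $G$ is nilpotent of class (at most) $k$ if and only if $G_{k+1}=\{e\}$, where $e$ is the identity; the words ''at most'' are often dropped, being understood. For a real number $x$, $\lfloor x\rfloor$ denotes the largest integer smaller than or equal to $x$.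
   Formalization: The formal theorem assumes in addition that G is nontrivial; for the trivial group with generating set {e} (r = 1, order p^0), which is capable and nilpotent of class at most k, the claim r > 1 fails. *)

(* Defs.v *)
From HB Require Import structures.
From mathcomp Require Export all_boot.
From mathcomp Require Export boolp classical_sets.

Set Implicit Arguments.
Unset Strict Implicit.
Unset Printing Implicit Defensive.

Local Open Scope group_scope.
Local Open Scope quotient_scope.
Local Open Scope classical_set_scope.

(* Groups are arbitrary (possibly infinite) MathComp [groupType]s; the choice
   structure carried by a [groupType] is no restriction, since the axioms of
   [boolp] provide one on every type. *)

Definition subgroup (G : groupType) (S : set G) : Prop := group_closed [in S].

Definition generated (G : groupType) (X : set G) : set G :=
  smallest (@subgroup G) X.

Definition has_order (G : groupType) (x : G) (n : nat) : Prop :=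
  [/\ (0 < n)%N, x ^+ n = 1 &
      forall m : nat, (0 < m)%N -> x ^+ m = 1 -> (n <= m)%N].

Definition p_group (p : nat) (G : groupType) : Prop :=
  forall x : G, exists n : nat, has_order x (p ^ n).

Definition commutator_subgroup (G : groupType) (A B : set G) : set G :=
  generated [set [~ a, b] | a in A & b in B].

(* Indexed from 1, so that [lower_central G 1] is the whole of [G]; the value
   at the index 0 is junk. *)
Definition lower_central (G : groupType) (n : nat) : set G :=
  iter n.-1 (fun A => commutator_subgroup A setT) setT.
Arguments lower_central : clear implicits.

(* Class at most [k]. *)
Definition nilpotent_of_class (k : nat) (G : groupType) : Prop :=
  lower_central G k.+1 = [set 1].

Definition center (H : groupType) : set H := [set z | forall x : H, commute z x].
Arguments center : clear implicits.

Section CenterQuotient.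
Variable H : groupType.

Definition center_eqv (x y : H) : bool := x^-1 * y \in center H.

Lemma center_eqvP (x y : H) :
  reflect (exists2 z : H, center H z & y = x * z) (center_eqv x y).
Proof.
apply: (iffP idP) => [|[z Zz ->]]; rewrite /center_eqv.
  by move/set_mem=> Z; exists (x^-1 * y); rewrite // mulVKg.
by rewrite mulKg; apply/mem_set.
Qed.

Lemma center1 : center H 1.
Proof. by move=> x; rewrite /commute mul1g mulg1. Qed.

Lemma centerM z t : center H z -> center H t -> center H (z * t).
Proof. by move=> Zz Zt x; rewrite /commute -mulgA (Zt x) mulgA (Zz x) mulgA. Qed.

Lemma centerV z : center H z -> center H z^-1.
Proof.
by move=> Zz x; rewrite /commute; apply: (mulgI z); rewrite mulVKg mulgA (Zz x) mulgK.
Qed.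

Fact center_eqv_refl : reflexive center_eqv.
Proof.
by move=> x; apply/center_eqvP; exists 1; [exact: center1 | rewrite mulg1].
Qed.

Fact center_eqv_sym : symmetric center_eqv.
Proof.
suff s : forall x y, center_eqv x y -> center_eqv y x.
  by move=> x y; apply/idP/idP; exact: s.
move=> x y /center_eqvP[z Zz ->]; apply/center_eqvP.
exists z^-1; first exact: centerV.
by rewrite mulgK.
Qed.

Fact center_eqv_trans : transitive center_eqv.
Proof.
move=> y x z /center_eqvP[u Zu ->] /center_eqvP[v Zv ->].
by apply/center_eqvP; exists (u * v); [exact: centerM | rewrite mulgA].
Qed.

Canonical center_equiv :=
  EquivRel center_eqv center_eqv_refl center_eqv_sym center_eqv_trans.

(* H / Z(H): the classes of [center_eqv] are the cosets x Z(H). *)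
Definition center_quot : Type := {eq_quot center_equiv}.

HB.instance Definition _ := EqQuotient.on center_quot.
HB.instance Definition _ := Choice.on center_quot.

Definition center_quot_one : center_quot := lift_cst center_quot 1.
Definition center_quot_mul := lift_op2 center_quot (@mul H).
Definition center_quot_inv := lift_op1 center_quot (@inv H).

Lemma pi_center_quot_mul : {morph \pi_center_quot : x y / x * y >-> center_quot_mul x y}.
Proof.
move=> x y; unlock center_quot_mul; apply/eqmodP/center_eqvP => /=.
have [u Zu ->] : exists2 u, center H u & repr (\pi_center_quot x) = x * u.
  by apply/center_eqvP/(eqmodP center_equiv); rewrite reprK.
have [v Zv ->] : exists2 v, center H v & repr (\pi_center_quot y) = y * v.
  by apply/center_eqvP/(eqmodP center_equiv); rewrite reprK.
exists (u * v); first exact: centerM.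
by rewrite mulgA -[x * u * y]mulgA (Zu y) !mulgA.
Qed.

Lemma pi_center_quot_inv : {morph \pi_center_quot : x / x^-1 >-> center_quot_inv x}.
Proof.
move=> x; unlock center_quot_inv; apply/eqmodP/center_eqvP => /=.
have [u Zu ->] : exists2 u, center H u & repr (\pi_center_quot x) = x * u.
  by apply/center_eqvP/(eqmodP center_equiv); rewrite reprK.
exists u^-1; first exact: centerV.
by rewrite invgM (centerV Zu).
Qed.

Fact center_quot_mulgA : associative center_quot_mul.
Proof.
move=> x y z; rewrite -[x]reprK -[y]reprK -[z]reprK.
by rewrite -!pi_center_quot_mul mulgA.
Qed.

Fact center_quot_mul1g : left_id center_quot_one center_quot_mul.
Proof.
move=> x; rewrite /center_quot_one; unlock; rewrite -[x]reprK.
by rewrite -pi_center_quot_mul mul1g.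
Qed.

Fact center_quot_mulg1 : right_id center_quot_one center_quot_mul.
Proof.
move=> x; rewrite /center_quot_one; unlock; rewrite -[x]reprK.
by rewrite -pi_center_quot_mul mulg1.
Qed.

Fact center_quot_mulVg : left_inverse center_quot_one center_quot_inv center_quot_mul.
Proof.
move=> x; rewrite /center_quot_one; unlock; rewrite -[x]reprK.
by rewrite -pi_center_quot_inv -pi_center_quot_mul mulVg.
Qed.

Fact center_quot_mulgV : right_inverse center_quot_one center_quot_inv center_quot_mul.
Proof.
move=> x; rewrite /center_quot_one; unlock; rewrite -[x]reprK.
by rewrite -pi_center_quot_inv -pi_center_quot_mul mulgV.
Qed.

HB.instance Definition _ := isGroup.Build center_quot center_quot_mulgA
  center_quot_mul1g center_quot_mulg1 center_quot_mulVg center_quot_mulgV.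

End CenterQuotient.

Definition capable (G : groupType) : Prop :=
  exists (H : groupType) (f : {multiplicative G -> center_quot H}), bijective f.

(* Main.v *)
From HB Require Import structures.
From mathcomp Require Import zify.
Require Import Defs.

(** Write G = H / Z(H), lift the generator x_i to y_i, and put a = alpha_(r-1),
    so that y_i^(p^a) is central in H for i < r. Fix i < r and consider the
    series A_0 = {y_i}, A_(j+1) = [A_j, H]; as H has class k+1, A_(k+1) is
    trivial. The Hall-Petrescu formula
      (v g)^n = v^n c_2^C(n,2) ... c_n^C(n,n) g^n   with v in A_j, c_i in A_(j+i-1)
    shows by induction on d that v^(p^(a + d/(p-1))) lies in A_(j+d+1) for all
    v in A_j with j > 0: for a generator v = [u, z], expand
    [u^n, z] = u^-n (u [u, z])^n, where u^n is either central (j = 1) or deep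
    enough by induction on j. The same formula applied to
    y_r^(y_i) = y_r [y_r, y_i] then shows that the power of y_r of exponent
    p^(a + (k-1)/(p-1)) commutes with y_i. It commutes with every lifted
    generator, so it is central and its image in G is trivial.
    The Hall-Petrescu formula is obtained as the Taylor expansion of a
    polynomial sequence in a filtered group; polynomial sequences form a group
    by Leibman's theorem. *)

Set Implicit Arguments.
Unset Strict Implicit.
Unset Printing Implicit Defensive.

Local Open Scope group_scope.
Local Open Scope classical_set_scope.

(** * Subgroups and commutator subgroups as sets *)

Section Subgroups.
Variable G : groupType.
Implicit Types (S X A : set G) (x y g : G).

Lemma subgroupP S :
  subgroup S <-> S 1 /\ (forall x y, S x -> S y -> S (x / y)).
Proof.
split=> [[S1 SB]|[S1 SB]]; split.
- exact: set_mem S1.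
- by move=> x y Sx Sy; apply/set_mem/SB; apply/mem_set.
- exact/mem_set.
- by move=> x y /set_mem Sx /set_mem Sy; apply/mem_set/SB.
Qed.

Section Closure.
Variables (S : set G) (Ssub : subgroup S).

Lemma subgroup1 : S 1.
Proof. by case/subgroupP: Ssub. Qed.

Lemma subgroupB x y : S x -> S y -> S (x / y).
Proof. by case/subgroupP: Ssub => _; exact. Qed.

Lemma subgroupV x : S x -> S x^-1.
Proof. by move=> Sx; rewrite -[x^-1]mul1g; apply: subgroupB => //; exact: subgroup1. Qed.

Lemma subgroupM x y : S x -> S y -> S (x * y).
Proof. by move=> Sx /subgroupV Sy; rewrite -[y]invgK; apply: subgroupB. Qed.

Lemma subgroupX x n : S x -> S (x ^+ n).
Proof.
move=> Sx; elim: n => [|n IH]; first exact: subgroup1.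
by rewrite expgS; apply: subgroupM.
Qed.

Lemma subgroupX_dvd x m n : (m %| n)%N -> S (x ^+ m) -> S (x ^+ n).
Proof. by case/dvdnP=> q -> Sx; rewrite mulnC expgnA; apply: subgroupX. Qed.

End Closure.

Definition normal_subgroup S := subgroup S /\ forall x g, S x -> S (x ^ g).

Lemma normal_commg S x g : normal_subgroup S -> S x -> S [~ x, g].
Proof.
case=> Ssub Snorm Sx; rewrite commgEl.
by apply: subgroupM => //; [apply: subgroupV | apply: Snorm].
Qed.

Lemma sub_generated X : X `<=` generated X.
Proof. exact: sub_gen_smallest. Qed.

Lemma generated_sub X S : subgroup S -> X `<=` S -> generated X `<=` S.
Proof. exact: smallest_sub. Qed.

Lemma subgroup_generated X : subgroup (generated X).
Proof.
apply/subgroupP; split; first by move=> S [Ssub _]; exact: subgroup1.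
by move=> x y Xx Xy S SX; apply: subgroupB (Xx _ SX) (Xy _ SX); case: SX.
Qed.

Lemma commg_commutator A x g : A x -> commutator_subgroup A setT [~ x, g].
Proof. by move=> Ax; apply: sub_generated; exists x => //; exists g. Qed.

Lemma commutator_subgroup_sub A S :
    subgroup S -> (forall x g, A x -> S [~ x, g]) ->
  commutator_subgroup A setT `<=` S.
Proof.
by move=> Ssub AS; apply: generated_sub => // _ [x Ax [g _ <-]]; apply: AS.
Qed.

(* [x, gh] = [x, h] [x, g]^h, so A itself need not be normal, nor a subgroup. *)
Lemma normal_commutator A : normal_subgroup (commutator_subgroup A setT).
Proof.
split=> [|x h]; first exact: subgroup_generated.
have Csub : subgroup (commutator_subgroup A setT) by apply: subgroup_generated.
have : commutator_subgroup A setT `<=`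
    [set x | commutator_subgroup A setT (x ^ h)].
  apply: commutator_subgroup_sub => [|{}x g Ax] /=.
    apply/subgroupP; split=> [|y z]; rewrite /= ?conj1g; first exact: (subgroup1 Csub).
    by rewrite conjMg conjVg; apply: (subgroupB Csub).
  have -> : [~ x, g] ^ h = [~ x, h]^-1 * [~ x, g * h].
    by rewrite /commg /conjg !gnorm.
  by apply: (subgroupM Csub); [apply: (subgroupV Csub)|]; apply: commg_commutator.
by move=> sAC /sAC.
Qed.

End Subgroups.

(** * Filtrations of a group by subgroups *)

Section NSeries.
Variable G : groupType.
Implicit Types (B : nat -> set G) (f g h : G).

Record nseries B : Prop := NSeries {
  nseries_subgroup : forall d, subgroup (B d);
  nseries_le1 : forall d, B d.+1 `<=` B d;
  nseries_commg : forall d e f g, B d f -> B e g -> B (d + e)%N [~ f, g] }.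

Variable B : nat -> set G.
Hypothesis nsB : nseries B.

Let Bsub d := nseries_subgroup nsB d.

Lemma nseries_le d e : (d <= e)%N -> B e `<=` B d.
Proof.
move=> /subnK <-; elim: (e - d)%N => [//|n IH] f.
by rewrite addSn => /(nseries_le1 nsB); exact: IH.
Qed.

Lemma nseriesJ d f g : B d f -> B 0 g -> B d (f ^ g).
Proof.
move=> Bf Bg; rewrite -[f ^ g](mulVKg f) -/(commg f g).
by apply: (subgroupM (Bsub d)) => //; rewrite -[d]addn0; apply: nseries_commg.
Qed.

End NSeries.

(* For Leibman's theorem: applied to the shift on sequences,
   [f^-1 * s f] is the discrete derivative of [f]. *)
Section Differentiation.
Variables (G : groupType) (s : UMagmaMorphism.type G G).
Implicit Types (B : nat -> set G) (f g : G).

Definition diff f := f^-1 * s f.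

Definition diff_series B : nat -> set G :=
  fun d => [set f | B d f /\ B d.+1 (diff f)].

Lemma nseries_diff B : nseries B -> nseries (diff_series B).
Proof.
move=> nsB; have Bsub := nseries_subgroup nsB.
have B1 d := subgroup1 (Bsub d); have BM d := subgroupM (Bsub d).
have BV d := subgroupV (Bsub d); have Ble := nseries_le nsB.
have BR d e n f g : (n <= d + e)%N -> B d f -> B e g -> B n [~ f, g].
  by move=> le_n Bf Bg; apply: (Ble _ _ le_n); apply: nseries_commg.
have BJ d e f g : B d f -> B e g -> B d (f ^ g).
  by move=> Bf Bg; apply: nseriesJ => //; apply: (Ble _ e).
have BD d f : diff_series B d f -> B d (s f).
  case=> Bf BDf; rewrite -[s f](mulVKg f) -/(diff f).
  by apply: BM => //; apply: nseries_le1.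
split=> [d|d f [Bf BDf]|d e f g].
- apply/subgroupP; split; first by split; rewrite // /diff gmulf1 mulVg.
  move=> f g [Bf BDf] [Bg BDg]; split; first exact: subgroupB.
  have -> : diff (f / g) = (diff f * (diff g)^-1) ^ (g^-1).
    by rewrite /diff gmulfM gmulfV /conjg !gnorm.
  apply: (BJ _ d); last exact: BV.
  by apply: BM => //; apply: BV.
- by split; apply: nseries_le1.
move=> /[dup] Df [Bf BDf] /[dup] Dg [Bg BDg]; split; first exact: nseries_commg.
have Bc : B (d + e)%N [~ f, g] by apply: nseries_commg.
(* Each factor lies in [B (d + e).+1]: the outer two because a derivative gains one degree, the
   middle one because [diff g * diff f] lies in [B 1]. *)
have -> : diff [~ f, g] =
    ([~ f, diff g] ^ diff f) ^ [~ f, g] * [~ [~ f, g], diff g * diff f]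
    * [~ diff f, s g].
  by rewrite /diff gmulfR /commg /conjg !gnorm.
apply: (BM); first apply: (BM).
- apply: (BJ _ _ _ _ _ Bc); apply: (BJ _ _ _ _ _ BDf).
  by apply: (BR _ _ _ _ _ _ Bf BDg); rewrite addnS.
- apply: (BR _ 1%N _ _ _ _ Bc); first by rewrite addn1.
  by apply: (BM); [apply: (Ble _ e.+1) | apply: (Ble _ d.+1)].
- by apply: (BR _ _ _ _ _ _ BDf (BD _ _ Dg)); rewrite addSn.
Qed.

End Differentiation.

(** * The group of sequences under pointwise product *)

Section Sequences.
Variable G : groupType.

Definition seq_mul (f g : nat -> G) := fun n => f n * g n.
Definition seq_inv (f : nat -> G) := fun n => (f n)^-1.
Definition seq_one : nat -> G := fun=> 1.

Fact seq_mulA : associative seq_mul.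
Proof. by move=> f g h; apply/funext => n; apply: mulgA. Qed.
Fact seq_mul1g : left_id seq_one seq_mul.
Proof. by move=> f; apply/funext => n; apply: mul1g. Qed.
Fact seq_mulg1 : right_id seq_one seq_mul.
Proof. by move=> f; apply/funext => n; apply: mulg1. Qed.
Fact seq_mulVg : left_inverse seq_one seq_inv seq_mul.
Proof. by move=> f; apply/funext => n; apply: mulVg. Qed.
Fact seq_mulgV : right_inverse seq_one seq_inv seq_mul.
Proof. by move=> f; apply/funext => n; apply: mulgV. Qed.

HB.instance Definition _ := isGroup.Build (nat -> G)
  seq_mulA seq_mul1g seq_mulg1 seq_mulVg seq_mulgV.

Definition shift (f : nat -> G) : nat -> G := fun n => f n.+1.
Fact shift_monoid_morphism : monoid_morphism shift.
Proof. by []. Qed.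
HB.instance Definition _ :=
  isUMagmaMorphism.Build (nat -> G) (nat -> G) shift shift_monoid_morphism.

End Sequences.

Lemma diff_shiftE (G : groupType) (f : nat -> G) n :
  diff (@shift G) f n = (f n)^-1 * f n.+1.
Proof. by []. Qed.

(** * Polynomial sequences and their Taylor expansion *)

Section Polynomials.
Variables (G : groupType) (B : nat -> set G).
Hypothesis nsB : nseries B.
Implicit Types (f g : nat -> G) (c : G).

(** Polynomiality tested up to order [K]: for j <= K, the j-th derivative takes its values in
    [B (d + j)]. *)
Definition poly_series K : nat -> set (nat -> G) :=
  iter K (diff_series (@shift G)) (fun d => [set f | forall n, B d (f n)]).

Lemma nseries_poly K : nseries (poly_series K).
Proof.
elim: K => [|K IH]; last exact: nseries_diff.
split=> [d|d f Bf n|d e f g Bf Bg n].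
- apply/subgroupP; split=> [n|f g Bf Bg n].
    exact: subgroup1 (nseries_subgroup nsB d).
  exact: (subgroupB (nseries_subgroup nsB d) (Bf n) (Bg n)).
- exact: nseries_le1 (Bf n).
- exact: (nseries_commg nsB (Bf n) (Bg n)).
Qed.

Lemma poly_seriesS K d f :
  poly_series K.+1 d f <-> poly_series K d f /\ poly_series K d.+1 (diff (@shift G) f).
Proof. by []. Qed.

Lemma poly_series_val K d f n : poly_series K d f -> B d (f n).
Proof. by elim: K f => [|K IH] f; [exact | move/poly_seriesS => [/IH]]. Qed.

(** By Pascal's rule, differentiating lowers [i] by one while the required degree [d] rises by
    one. *)
Lemma poly_series_binomial K d i c :
  B (d + i)%N c -> poly_series K d (fun n => c ^+ 'C(n, i)).
Proof.
have Bsub := nseries_subgroup nsB.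
elim: K d i => [|K IH] d i Bc.
  move=> n; apply: (subgroupX (Bsub d)).
  by apply: (nseries_le nsB _ Bc); apply: leq_addr.
apply/poly_seriesS; split; first exact: IH.
case: i Bc => [|i] Bc.
  have -> : diff (@shift G) (fun n => c ^+ 'C(n, 0)) = 1.
    by apply/funext => n; rewrite diff_shiftE !bin0; apply: mulVg.
  exact: subgroup1 (nseries_subgroup (nseries_poly K) _).
have -> : diff (@shift G) (fun n => c ^+ 'C(n, i.+1)) = fun n => c ^+ 'C(n, i).
  by apply/funext => n; rewrite diff_shiftE binS expgnDr mulKg.
by apply: IH; rewrite addSnnS.
Qed.

(** For N > 0 the derivative is trivial before N - 1 and equals [f N] at N - 1, with degree d +
    1. *)
Lemma poly_series_first_value K d N f :
    (N <= K)%N -> (forall n, (n < N)%N -> f n = 1) -> poly_series K d f ->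
  B (d + N)%N (f N).
Proof.
elim: N K d f => [|N IH] K d f leNK f1 Pf.
  by rewrite addn0; apply: poly_series_val Pf.
case: K leNK Pf => // K leNK /poly_seriesS[_].
move/(IH K) => /(_ leNK); rewrite addSnnS.
have -> : diff (@shift G) f N = f N.+1.
  by rewrite diff_shiftE f1 // invg1 mul1g.
apply=> n ltnN; rewrite diff_shiftE.
by rewrite !f1 ?invg1 ?mul1g // ltnW.
Qed.

(* The c_i are found one at a time: if f agrees with the product of the first
   N factors on [0, N), the quotient vanishes there, so its N-th difference at
   0 is its value at N. *)
Lemma taylor_expansion f :
    (forall K, poly_series K 0 f) ->
  forall N, exists2 c : nat -> G, forall i, B i (c i) &
    forall n, (n < N)%N -> f n = \prod_(i < N) c i ^+ 'C(n, i).
Proof.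
move=> Pf; elim=> [|N [c Bc fE]].
  by exists (fun=> 1) => // i; apply: (subgroup1 (nseries_subgroup nsB i)).
pose q : nat -> G := \prod_(i < N) (fun n => c i ^+ 'C(n, i)).
have qE n : q n = \prod_(i < N) c i ^+ 'C(n, i).
  by apply: (big_morph (fun h : nat -> G => h n)).
pose r := q^-1 * f.
have Br : B N (r N).
  have Psub := nseries_subgroup (nseries_poly N) 0.
  apply: (@poly_series_first_value N 0) => // [n ltnN|].
    have -> : r n = (q n)^-1 * f n by [].
    by rewrite fE // qE mulVg.
  apply: (subgroupM Psub) => //; apply: (subgroupV Psub).
  apply: big_ind => [|g h|i _]; [exact: (subgroup1 Psub) | exact: (subgroupM Psub)|].
  exact: poly_series_binomial.
have fE' : forall n, (n < N.+1)%N -> f n = q n * r N ^+ 'C(n, N).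
  move=> n; rewrite ltnS leq_eqVlt => /predU1P[->|ltnN].
    by rewrite binn expg1 mulVKg.
  by rewrite bin_small // mulg1 qE fE.
exists (fun i => if i == N then r N else c i) => [i|n ltnN]; first by case: eqP => [->|].
rewrite big_ord_recr /= eqxx fE' // qE; congr (_ * _).
by apply: eq_bigr => i _; rewrite ltn_eqF.
Qed.

End Polynomials.

(* f n = (v g)^n g^-n is polynomial, as its derivative is n |-> v^(g^-n). *)
Lemma expg_mul_mod (G : groupType) (B : nat -> set G) (M : set G) (n : nat) (v g : G) :
    nseries B -> (forall d, normal_subgroup (B d)) ->
    (forall d w h, B d.+1 w -> B d.+2 [~ w, h]) ->
    normal_subgroup M ->
    (forall i c, (1 < i <= n)%N -> B i c -> M (c ^+ 'C(n, i))) ->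
    B 1%N v ->
  M (v ^- n * ((v * g) ^+ n / g ^+ n)).
Proof.
move=> nsB Bnorm BR [Msub Mnorm] BM Bv.
pose f m := (v * g) ^+ m / g ^+ m.
have diff_f : diff (@shift G) f = fun m => v ^ (g^-1 ^+ m).
  apply/funext => m; rewrite diff_shiftE /f.
  by rewrite !expgSr expVgn /conjg !gnorm.
(* The derivative has the same form, with [[~ w, h]], one degree deeper, in place of [w]. *)
have Pconj K d h w : B d.+1 w -> poly_series B K d.+1 (fun m => w ^ (h ^+ m)).
  elim: K d w => [|K IH] d w Bw; first by move=> m; apply: (Bnorm _).2.
  apply/poly_seriesS; split; first exact: IH.
  have -> : diff (@shift G) (fun m => w ^ (h ^+ m)) = fun m => [~ w, h] ^ (h ^+ m).
    by apply/funext => m; rewrite diff_shiftE commgEl conjMg conjVg -conjgM -expgS.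
  exact/IH/BR.
have fS m : f m.+1 = f m * v ^ (g^-1 ^+ m).
  by rewrite -[v ^ _]/((fun m => v ^ (g^-1 ^+ m)) m) -diff_f; apply/esym/mulVKg.
have f0 : f 0 = 1 by rewrite /f mulgV.
have Pf K : poly_series B K 0 f.
  elim: K => [|K IH]; last first.
    by apply/poly_seriesS; rewrite diff_f; split=> //; apply: Pconj.
  elim=> [|m IH]; first by rewrite f0; apply: (subgroup1 (Bnorm 0).1).
  rewrite fS; apply: (subgroupM (Bnorm 0).1) => //; apply: (Bnorm 0).2.
  exact: (nseries_le nsB _ Bv).
(* Length n + 2 covers the argument 1 even when n = 0; the value there identifies [c 1] with [v]. *)
have [c Bc fE] := taylor_expansion nsB Pf n.+2.
have c0 : c 0 = 1.
  by rewrite -f0 fE // big_ord_recl big1 ?bin0 ?expg1 ?mulg1.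
have c1 : c 1%N = v.
  have := fE 1%N isT; rewrite fS f0 mul1g conjg1 => ->.
  rewrite !big_ord_recl big1 => [|i _]; last by rewrite bin_small.
  by rewrite c0 expg1n mul1g mulg1 bin1 expg1.
rewrite -/(f n) fE // !big_ord_recl /= c0 expg1n mul1g bin1 c1 mulKg.
apply: (big_ind M) => [|x y|i _]; [exact: (subgroup1 Msub) | exact: (subgroupM Msub) |].
have [lti|leni] := ltnP n i.+2; first by rewrite bin_small //; apply: (subgroup1 Msub).
by apply: BM; [rewrite /= leni | apply: Bc].
Qed.

(** * Iterated commutators of a set with the whole group *)

Section CommutatorSeries.
Variables (G : groupType) (X : set G).
Implicit Types (u v w g h : G).

Definition commutator_series i : set G :=
  iter i (fun A => commutator_subgroup A setT) X.
Local Notation A := commutator_series.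

Lemma normal_commutator_series i : normal_subgroup (A i.+1).
Proof. exact: normal_commutator. Qed.

Let Asub i := (normal_commutator_series i).1.
Let Anorm i := (normal_commutator_series i).2.

Lemma commutator_series_commg i u g : A i u -> A i.+1 [~ u, g].
Proof. exact: commg_commutator. Qed.

Lemma commutator_series_le i j : (i <= j)%N -> A j.+1 `<=` A i.+1.
Proof.
move/subnK <-; elim: (j - i)%N => [//|n IH]; apply: subset_trans IH.
apply: commutator_subgroup_sub => [|x g]; first exact: Asub.
by apply: normal_commg; apply: normal_commutator_series.
Qed.

(** Commuting with [A l] gains l + 1 steps, as with term l + 1 of the lower central series; the
    induction on [l] is the three subgroups argument. *)
Lemma commutator_seriesR i l u w :
  A i.+1 u -> A l w -> A (i + l).+2 [~ u, w].
Proof.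
have VJ (x y : G) : [~ x, y^-1] = ([~ x, y]^-1) ^ y^-1.
  by rewrite /commg /conjg !gnorm.
elim: l i u w => [|l IH] i u w Au.
  by rewrite addn0 => _; apply: commutator_series_commg.
pose S := [set w | forall i u, A i.+1 u -> A (i + l).+3 [~ u, w]].
suff: A l.+1 `<=` S by move=> sAS /sAS; rewrite addnS; apply.
apply: commutator_subgroup_sub => {i u w Au} [|s h As i u Au].
  apply/subgroupP; split=> [i u _|w1 w2 Sw1 Sw2 i u Au].
    by rewrite commg1; apply: (subgroup1 (Asub _)).
  have -> : [~ u, w1 / w2] = ([~ u, w2]^-1 * [~ u, w1]) ^ w2^-1.
    by rewrite /commg /conjg !gnorm.
  apply: (Anorm _); apply: (subgroupM (Asub _)); last exact: Sw1.
  by apply: (subgroupV (Asub _)); apply: Sw2.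
(* the Hall-Witt identity *)
have -> : [~ u, [~ s, h]] =
    ([~ [~ h^-1, u^-1], s] ^ u * [~ [~ u, s^-1], h^-1] ^ s) ^ h.
  by rewrite /commg /conjg !gnorm.
apply: (Anorm _); apply: (subgroupM (Asub _)); apply: (Anorm _).
  rewrite -addSn; apply: IH => //; rewrite -invgR; apply: (subgroupV (Asub _)).
  by apply: commutator_series_commg; apply: (subgroupV (Asub _)).
apply: commutator_series_commg; rewrite VJ; apply: (Anorm _).
by apply: (subgroupV (Asub _)); apply: IH.
Qed.

(** Since [0.-1] is 0, terms 0 and 1 are both [A j.+1], which puts an element of [A j.+1] in degree
    1. *)
Lemma nseries_commutator_series j : nseries (fun i => A (j + i.-1).+1).
Proof.
split=> [d|d|d e u w Au Aw]; first exact: Asub.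
  by apply: commutator_series_le; lia.
by apply: commutator_series_le (commutator_seriesR Au Aw); lia.
Qed.

End CommutatorSeries.

(** From i C(p^b, i) = p^b C(p^b - 1, i - 1), on removing first the p-part of i, then its cofactor
    prime to p. *)
Lemma dvdn_bin_pfactor p b i :
  prime p -> (0 < i)%N -> (p ^ (b - logn p i) %| 'C(p ^ b, i))%N.
Proof.
move=> p_pr i_gt0; have [lebi|ltib] := leqP b (logn p i).
  by rewrite (eqP (_ : b - logn p i == 0)%N) ?dvd1n // subn_eq0.
have := mul_bin_diag (p ^ b) i.-1; rewrite prednK // => bin_eq.
rewrite -(@dvdn_pmul2l (p ^ logn p i)) ?expn_gt0 ?prime_gt0 //.
rewrite -expnD subnKC ?(ltnW ltib) //.
have [m co_pm i_eq] := pfactor_coprime p_pr i_gt0.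
rewrite -(@Gauss_dvdr _ m) ?coprimeXl // mulnA -i_eq -bin_eq.
exact: dvdn_mulr.
Qed.

(** With v = [logn p i], Bernoulli's inequality gives v (p - 1) < p^v, and p^v divides i. *)
Lemma logn_ltn p i : prime p -> (0 < i)%N -> (logn p i * (p - 1) < i)%N.
Proof.
move=> p_pr i_gt0; apply: (@leq_trans (p ^ logn p i)); last first.
  by apply: dvdn_leq => //; apply: pfactor_dvdnn.
have p_gt1 := prime_gt1 p_pr.
elim: (logn p i) => [|v IH]; first by rewrite mul0n expn0.
by rewrite expnS mulSn; nia.
Qed.

(** * Prime powers along the commutator series *)

Section Exponents.
Variables (G : groupType) (X : set G) (p a : nat).
Hypotheses (p_pr : prime p) (Xcentral : forall u, X u -> center G (u ^+ (p ^ a))).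
Local Notation A := (commutator_series X).
Local Notation e d := (p ^ (a + d %/ (p - 1)))%N.

(* The factor c_i^C(n,i) vanishes modulo A because C(n,i) loses at most
   log_p i <= (i-1)/(p-1) factors p while c_i lies i-1 steps deeper. *)
Lemma commutator_series_expgM j d v g :
    (forall d', (d' < d)%N -> forall j v, A j.+1 v -> A (j + d').+2 (v ^+ e d')) ->
    A j.+1 v ->
  A (j + d).+2 (v ^- e d * ((v * g) ^+ e d / g ^+ e d)).
Proof.
move=> IHd Av; have Asub i := (normal_commutator_series X i).1.
apply: (@expg_mul_mod _ _ _ _ _ _ (nseries_commutator_series X j))
  => [?|i w h Aw||i c|].
- exact: normal_commutator_series.
- by rewrite /= addnS; apply: commutator_series_commg Aw.
- exact: normal_commutator_series.
(* If i - 1 > d, then [c] is already deep enough; otherwise the hypothesis applies at d - (i -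
   1). *)
- case/andP=> i_gt1 _ Ac; have [led|ltd] := leqP i.-1 d; last first.
    by apply: (subgroupX (Asub _)); apply: commutator_series_le Ac; lia.
  have -> : (j + d).+2 = (j + i.-1 + (d - i.-1)).+2 by lia.
  apply: (@subgroupX_dvd _ _ (Asub _) c (e (d - i.-1))); last by apply: IHd => //; lia.
  apply: dvdn_trans (dvdn_bin_pfactor _ p_pr (ltnW i_gt1)).
  apply: dvdn_exp2l; have p1_gt0 : (0 < p - 1)%N by rewrite subn_gt0 prime_gt1.
  have := logn_ltn p_pr (ltnW i_gt1) => logi.
  rewrite -addnBA; last first.
    by rewrite leq_divRL //; lia.
  rewrite leq_add2l leq_subRL -?leq_divRL ?(leq_divRL _ _ p1_gt0) //; last by lia.
  rewrite mulnDl; have := leq_trunc_div (d - i.-1) (p - 1); lia.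
- by rewrite addn0.
Qed.

(** Gives a conjugate the shape [v * g] expanded by [commutator_series_expgM]. *)
Lemma conjg_commg (g h : G) : g ^ h = [~ g, h] ^ g^-1 * g.
Proof. by rewrite /commg /conjg !gnorm. Qed.

Lemma commutator_series_expg d j v : A j.+1 v -> A (j + d).+2 (v ^+ e d).
Proof.
elim/ltn_ind: d j v => d IHd j v.
(* The premise has two sources: for i = 0 the power of [u] is central, for i > 0 it is deep by
   induction on [j]. *)
suff step i : (forall u z, A i u -> A (i + d).+2 [~ u ^+ e d, z]) ->
    A i.+1 `<=` [set v | A (i + d).+2 (v ^+ e d)].
  elim: j v => [|j IHj] v; apply: step => u z Au; last first.
    by apply: commutator_series_commg; apply: IHj.
  have -> : [~ u ^+ e d, z] = 1.
    apply/eqP/commgP; rewrite expnD expgnA.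
    by apply/commute_sym/commuteX/commute_sym/Xcentral.
  exact: (subgroup1 (normal_commutator_series _ _).1).
move=> Xe {j v}.
have Msub := (normal_commutator_series X (i + d).+1).1.
have Mnorm := (normal_commutator_series X (i + d).+1).2.
have Asub := (normal_commutator_series X i).1.
have Anorm := (normal_commutator_series X i).2.
(* This makes the elements of [A i.+1] with deep power a subgroup, so only the generators [[~ u, z]]
   remain. *)
have expM v g : A i.+1 v -> A (i + d).+2 (v ^+ e d) ->
    A (i + d).+2 (g ^+ e d) -> A (i + d).+2 ((v * g) ^+ e d).
  move=> Av Mv Mg; rewrite -[_ ^+ _](mulgVK (g ^+ e d)).
  apply: (subgroupM Msub) => //; rewrite -[_ / _](mulVKg (v ^+ e d)).
  by apply: (subgroupM Msub) => //; apply: commutator_series_expgM.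
suff sA : A i.+1 `<=` [set v | A i.+1 v /\ A (i + d).+2 (v ^+ e d)].
  by move=> v /sA[].
apply: commutator_subgroup_sub => [|u z Au].
  apply/subgroupP; split=> [|v w [Av Mv] [Aw Mw]].
    by split; [apply: (subgroup1 Asub) | rewrite expg1n; apply: (subgroup1 Msub)].
  split; first exact: (subgroupB Asub).
  by apply: expM => //; rewrite expVgn; apply: (subgroupV Msub).
have Auz : A i.+1 [~ u, z] by apply: commutator_series_commg.
(* As [w * u] is [u ^ z], expanding its power compares that of [w] with a conjugate of
   [[~ u ^+ e d, z]], which is deep by [Xe]. *)
split=> //; pose w := [~ u, z] ^ u^-1.
have Mw : A (i + d).+2 (w ^- e d).
  have := commutator_series_expgM u IHd (Anorm _ u^-1 Auz : A i.+1 w).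
  rewrite -conjg_commg -[(u ^ z) ^+ _]conjXg conjg_commg mulgK.
  rewrite -[w ^- e d in X in _ -> X](mulgK ([~ u ^+ e d, z] ^ u ^- e d)).
  by move/(subgroupB Msub); apply; apply: Mnorm; apply: Xe.
rewrite -[_ ^+ _](conjgKV u) conjXg; apply: Mnorm.
by rewrite -[_ ^+ _]invgK; apply: (subgroupV Msub).
Qed.

(** Here y^x = v y with [v] in [A 1]; the power of [v] and the correction terms lie in [A d.+2], so
    y^x and y have equal powers. *)
Lemma commute_expg d x y : A d.+2 `<=` [set 1] -> X x -> commute x (y ^+ e d).
Proof.
move=> A1 Xx; pose v := [~ y, x] ^ y^-1.
have Av : A 1 v.
  apply: (normal_commutator_series X 0).2; rewrite -invgR.
  apply: (subgroupV (normal_commutator_series X 0).1).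
  exact: commutator_series_commg.
have v1 : v ^+ e d = 1 by apply: A1; apply: (@commutator_series_expg d 0).
have := commutator_series_expgM y (fun d' _ => @commutator_series_expg d') Av.
move=> /(_ d) /A1 /=; rewrite v1 invg1 mul1g -conjg_commg => /divg1_eq.
by rewrite -conjXg => /eqP; rewrite conjg_fix => /commgP/commute_sym.
Qed.

End Exponents.

(** * Lower central series, capability and the bound *)

Lemma commutator_series_lower_central (G : groupType) (X : set G) i :
  commutator_series X i `<=` lower_central G i.+1.
Proof.
elim: i => [//|i IH]; apply: commutator_subgroup_sub => [|x g /IH Gx].
  exact: subgroup_generated.
exact: commg_commutator.
Qed.

Lemma lower_central_morphism (H G : groupType) (f : UMagmaMorphism.type H G) n h :
  lower_central H n h -> lower_central G n (f h).
Proof.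
rewrite /lower_central; elim: n.-1 h => [//|i IH].
suff : iter i.+1 (fun A => commutator_subgroup A setT) setT
    `<=` [set h | iter i.+1 (fun A => commutator_subgroup A setT) setT (f h)] by [].
have Ssub := subgroup_generated (G := G).
apply: commutator_subgroup_sub => [|x g Hx] /=; last first.
  by rewrite gmulfR; apply: commg_commutator; apply: IH.
apply/subgroupP; split=> [|x y] /=; rewrite ?gmulf1 ?gmulfF.
  exact: (subgroup1 (Ssub _)).
exact: (subgroupB (Ssub _)).
Qed.

(** Composing the projection with the inverse isomorphism eliminates the quotient type. *)
Lemma capable_cover (G : groupType) : capable G ->
  exists (H : groupType) (f : UMagmaMorphism.type H G),
    (forall g, exists h, f h = g) /\ (forall h, f h = 1 <-> center H h).
Proof.
case=> H [q [q' qK q'K]].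
pose f (h : H) : G := q' (\pi_(center_quot H)%qT h).
have fM : {morph f : x y / x * y}.
  by move=> x y; rewrite /f pi_center_quot_mul (can2_gmulfM qK q'K).
have f1 : f 1 = 1 by apply: (mulgI (f 1)); rewrite -fM !mulg1.
pose F : UMagmaMorphism.type H G :=
  HB.pack f (isUMagmaMorphism.Build H G f (conj f1 fM)).
exists H, F; split=> [g|h].
  by exists (repr (q g)); rewrite /= /f reprK qK.
have -> : (F h = 1) <-> (\pi_(center_quot H)%qT h = \pi_(center_quot H)%qT 1).
  split=> [Fh1|pi_h1]; last by rewrite -f1 /= /f pi_h1.
  by apply: (can_inj q'K); rewrite -/(f h) -/(f 1) f1.
split=> [/esym/eqmodP/center_eqvP[z Zz ->]|Zh]; first by rewrite mul1g.
by apply/esym/eqmodP/center_eqvP; exists h; rewrite ?mul1g.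
Qed.

Lemma subgroup_set1 (G : groupType) : subgroup [set 1 : G].
Proof. by apply/subgroupP; split=> // x y /= -> ->; rewrite divg1. Qed.

Theorem theorem3p19 (G : groupType) (p k r : nat)
    (x : r.-tuple G) (alpha : r.-tuple nat) :
  prime p -> (1 <= k)%N ->
  p_group p G -> nilpotent_of_class k G ->
  (exists g : G, g != 1) ->
  generated [set` x] = [set: G] ->
  (forall i : 'I_r, has_order (tnth x i) (p ^ tnth alpha i)) ->
  sorted leq alpha ->
  capable G ->
  (1 < r)%N /\
  (nth 0 alpha r.-1 <= nth 0 alpha r.-2 + (k - 1) %/ (p - 1))%N.
Proof.
move=> p_pr k_gt0 _ Gnil [g0 g0_neq1] genG ordx alpha_sorted /capable_cover.
case=> H [f [fsurj fker]].
(* [f] kills term k + 1 of the lower central series of [H], so that term is central. *)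
have Hnil : lower_central H k.+2 `<=` [set 1].
  apply: commutator_subgroup_sub => [|h h' Hh].
    exact: subgroup_set1.
  apply/eqP/commgP; apply: (fker h).1.
  by have := lower_central_morphism f (Hh : lower_central H k.+1 h); rewrite Gnil.
(* Lifts of the generators together with the center, the kernel of [f], generate [H]. *)
have lift1 w : (forall i, exists2 y, f y = tnth x i & commute w y) -> f w = 1.
  move=> wx; apply/fker => h.
  pose S := [set g | exists2 y, f y = g & commute w y].
  have /(_ (f h) I) [y fy wy] : [set: G] `<=` S.
    rewrite -genG; apply: generated_sub => [|_ /= /tnthP[i ->]]; last exact: wx.
    apply/subgroupP; split=> [|_ _ [y1 <- wy1] [y2 <- wy2]].
      by exists 1; [apply: gmulf1 | apply: commute1].
    by exists (y1 / y2); [apply: gmulfF | apply/commuteM/commuteV].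
  rewrite -[h](mulVKg y); apply: commuteM => //.
  by apply/commute_sym/(fker _).1; rewrite gmulfM gmulfV fy mulVg.
have Gx1 : (forall i, tnth x i = 1) -> False.
  move=> x1; move/eqP: g0_neq1; apply.
  have : [set: G] `<=` [set 1]; last by move/(_ g0 I).
  rewrite -genG; apply: generated_sub => [|_ /= /tnthP[i ->]]; last exact: x1.
  exact: subgroup_set1.
(* The lift of a sole generator commutes with itself, hence is central, which would make [G]
   trivial. *)
have r_gt1 : (1 < r)%N.
  rewrite ltnNge; apply/negP => r_le1; apply: Gx1 => i.
  have [y fy] := fsurj (tnth x i); rewrite -fy; apply: lift1 => j.
  have -> : j = i by apply/val_inj; move: (ltn_ord i) (ltn_ord j) => /=; lia.
  by exists y.
split=> //.
have lt1 : (r.-1 < r)%N by lia.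
have lt2 : (r.-2 < r)%N by lia.
pose i1 := Ordinal lt1.
set a := nth 0 alpha r.-2; set m := (_ %/ _)%N.
have [y fy] := fsurj (tnth x i1).
have fw1 : f (y ^+ (p ^ (a + m))) = 1.
  apply: lift1 => j; have [->|neqj] := eqVneq j i1.
    by exists y => //; apply/commute_sym/commuteX.
  have [z fz] := fsurj (tnth x j); exists z => //; apply: commute_sym.
  (* With d = k - 1 the series of [z] must vanish at index k + 1, which lies in term k + 2 of the
     lower central series of [H]. *)
  apply: (@commute_expg _ [set z] p a p_pr _ (k - 1)) => // [_ ->|].
    apply/fker; rewrite gmulfXn fz.
    have [_ xj1 _] := ordx j.
    have le_aj : (tnth alpha j <= a)%N.
      rewrite (tnth_nth 0) /a; apply: (sorted_leq_nth leq_trans leqnn) => //.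
      - by rewrite inE size_tuple.
      - by rewrite inE size_tuple.
      - by move: neqj; rewrite -val_eqE /=; have := ltn_ord j; lia.
    by rewrite -(subnKC le_aj) expnD expgnA xj1 expg1n.
  apply: subset_trans Hnil.
  have -> : (k - 1).+2 = k.+1 by lia.
  exact: commutator_series_lower_central.
have [_ _ min_ord] := ordx i1.
move: fw1; rewrite gmulfXn fy => /min_ord; rewrite expn_gt0 prime_gt0 //.
by rewrite leq_exp2l ?prime_gt1 // (tnth_nth 0); apply.
Qed.
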